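(* Let $R$ be either a Noetherian local ring or a finitely generated graded $K$-algebra ($K$ a field, $R=\bigoplus_{i\ge 0}R_i$, $R_0=K$). Assume that $R$ is a normal Cohen--Macaulay domain with a canonical module $\omega_R$, and that the divisor class group $\mathrm{Cl}(R)$ is free of rank $r\geq 1$, so that $\mathrm{Cl}(R)\cong\mathbb{Z}^r$. Under this isomorphism let $[\omega_R]=(a_1,\dots,a_r)$ with $a_i\in\mathbb{Z}$. Then $d(R)=\gcd(a_1,\dots,a_r)$. In particular, $\overline{\mathrm{Cl}}(R)\cong\mathbb{Z}^{r-1}\oplus\mathbb{Z}/(d(R))$, and $[\omega_R]$ is part of a basis of $\mathrm{Cl}(R)$ if and only if $d(R)=1$.
   Context: The canonical module $\omega_R$ is identified with a divisorial ideal of $R$, and $[\omega_R]$ denotes its class in the divisor class group $\mathrm{Cl}(R)$ (written additively). In the graded case $\omega_R$ is the graded canonical module. The convention $\gcd(0,\dots,0)=0$ is used. Reduced divisor class group: $\overline{\mathrm{Cl}}(R)=\mathrm{Cl}(R)/\mathbb{Z}[\omega_R]$. Fitting ideals: for a finitely generated abelian group $G$ with generators $u_1,\dots,u_n$ and integer relation matrix $A$ (so that $G$ is the quotient of $\mathbb{Z}^n$ by the subgroup spanned by the relation vectors recorded in $A$), the $i$th Fitting ideal is $\mathrm{Fitt}_i(G)=I_{n-i}(A)\subseteq\mathbb{Z}$, the ideal generated by the $(n-i)$-minors of $A$ (with $I_k(A)=\mathbb{Z}$ for $k\le 0$, and $I_k(A)=0$ if $A$ has no $k$-minors). It does not depend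 on the choices of generators and relations, and $\mathrm{rank}\,G=\min\{i:\mathrm{Fitt}_i(G)\ne 0\}$. Torsion number: let $\rho=\mathrm{rank}\,\overline{\mathrm{Cl}}(R)$. If $\mathrm{Fitt}_\rho(\mathrm{Cl}(R))=\mathrm{Fitt}_\rho(\overline{\mathrm{Cl}}(R))$, set $d(R)=0$. Otherwise $d(R)$ is the nonnegative integer with $\mathrm{Fitt}_\rho(\overline{\mathrm{Cl}}(R))=(d(R))$. *)

(* Defs.v *)
From HB Require Import structures.
From mathcomp Require Import all_boot all_order all_algebra.
From mathcomp Require Import boolp classical_sets.

Set Implicit Arguments.
Unset Strict Implicit.
Unset Printing Implicit Defensive.

Import GRing.Theory.
Local Open Scope classical_set_scope.
Local Open Scope ring_scope.
Local Open Scope quotient_scope.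

Definition is_max (P : nat -> Prop) (n : nat) : Prop :=
  P n /\ forall m, P m -> (m <= n)%N.

Section Ideals.
Variable A : comNzRingType.
Implicit Types (I J P : set A) (x y : A).

Record is_ideal I : Prop := IsIdeal {
  ideal_0 : I 0;
  ideal_D : forall x y, I x -> I y -> I (x + y);
  ideal_M : forall a x, I x -> I (a * x) }.

Definition ideal_gen (S : set A) : set A := smallest is_ideal S.

Definition noetherian : Prop :=
  forall I, is_ideal I -> exists s : seq A, I = ideal_gen [set` s].

Definition prime_ideal P : Prop :=
  [/\ is_ideal P, ~ P 1 & forall x y, P (x * y) -> P x \/ P y].

Definition maximal_ideal P : Prop :=
  [/\ is_ideal P, ~ P 1 &
      forall J, is_ideal J -> P `<=` J -> ~ J 1 -> J = P].

Definition is_subring (S : set A) : Prop :=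
  [/\ S 1, forall x y, S x -> S y -> S (x - y)
         & forall x y, S x -> S y -> S (x * y)].

Lemma ideal_gen_is_ideal (S : set A) : is_ideal (ideal_gen S).
Proof.
split=> [|x y Sx Sy|a x Sx] J [idJ SJ]; first exact: ideal_0.
- by apply: ideal_D => //; [apply: Sx | apply: Sy].
- by apply: ideal_M => //; apply: Sx.
Qed.

Lemma ideal_gen_sub (S J : set A) : is_ideal J -> S `<=` J -> ideal_gen S `<=` J.
Proof. exact: smallest_sub. Qed.

Lemma sub_ideal_gen (S : set A) : S `<=` ideal_gen S.
Proof. exact: sub_gen_smallest. Qed.

End Ideals.

Section HilbertBasis.

Lemma noetherian_field (K : fieldType) : noetherian K.
Proof.
move=> I idI; case: (pselect (exists2 x, I x & x != 0)) => [[x Ix x0]|nI].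
  exists [:: x]; apply/seteqP; split=> [y _|].
    rewrite -[y](divfK x0); apply: (ideal_M (ideal_gen_is_ideal _)).
    by apply: sub_ideal_gen; rewrite /= inE.
  by apply: ideal_gen_sub => // y /=; rewrite inE => /eqP ->.
exists [::]; apply/seteqP; split=> [y Iy|].
  have [->|y0] := eqVneq y 0; first exact: ideal_0 (ideal_gen_is_ideal _).
  by case: nI; exists y.
by apply: ideal_gen_sub.
Qed.

Lemma noetherian_image (A B : comNzRingType) (f : {rmorphism A -> B}) :
  noetherian A -> (forall y, exists x, f x = y) -> noetherian B.
Proof.
move=> nA sf I idI.
have idJ : is_ideal (f @^-1` I).
  split=> [|x y|a x] /=; first by rewrite rmorph0; apply: ideal_0.
    by rewrite rmorphD; apply: ideal_D.
  by rewrite rmorphM; apply: ideal_M.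
have [s Js] := nA _ idJ; exists [seq f x | x <- s].
apply/seteqP; split=> [y Iy|]; last first.
  apply: ideal_gen_sub => // _ /mapP[x xs ->].
  have : [set` s] x by [].
  by move=> /(@sub_ideal_gen A); rewrite -Js.
have [x fx] := sf y; rewrite -fx in Iy *.
have: ideal_gen [set` s] x by rewrite -Js.
move: x {fx Iy}; apply: (@ideal_gen_sub _ _ (f @^-1` ideal_gen [set` [seq f x | x <- s]])).
  have idG := ideal_gen_is_ideal [set` [seq f x | x <- s]].
  split=> [|x z|a x] /=; first by rewrite rmorph0; apply: ideal_0.
    by rewrite rmorphD; apply: ideal_D.
  by rewrite rmorphM; apply: ideal_M.
by move=> x xs; apply: sub_ideal_gen; apply: map_f.
Qed.

Lemma noetherian_poly (A : comNzRingType) : noetherian A -> noetherian {poly A}.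
Proof.
move=> nA I idI.
pose lc (J : set {poly A}) d : set A :=
  [set a | exists h, [/\ J h, (size h <= d.+1)%N & h`_d = a]].
have lc_ideal J d : is_ideal J -> is_ideal (lc J d).
  move=> idJ; split=> [|x y [h [Jh sh hx]] [k [Jk sk ky]]|a x [h [Jh sh hx]]].
  - by exists 0; rewrite coef0 size_poly0; split=> //; apply: ideal_0.
  - exists (h + k); rewrite coefD hx ky; split=> //; first exact: ideal_D.
    by rewrite (leq_trans (size_polyD _ _)) // geq_max sh sk.
  - exists (a%:P * h); rewrite coefCM hx; split=> //; first exact: ideal_M.
    by rewrite mul_polyC (leq_trans (size_scale_leq _ _)).
have lcS J d e : is_ideal J -> (d <= e)%N -> lc J d `<=` lc J e.
  move=> idJ de a [h [Jh sh ha]]; exists ('X^(e - d) * h); split.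
  - exact: ideal_M.
  - rewrite (leq_trans (size_polyMleq _ _)) // size_polyXn /=.
    by rewrite (leq_trans (leq_add (leqnn _) sh)) // addnS subnK.
  - by rewrite coefXnM ltnNge leq_subr /= subKn.
(* a finite set of leading coefficients is realized by finitely many elements *)
have lift (s : seq A) : (forall a, a \in s -> exists d, lc I d a) ->
    exists N (t : seq {poly A}), (forall h, h \in t -> I h) /\
      forall J, is_ideal J -> (forall h, h \in t -> J h) ->
      forall a, a \in s -> lc J N a.
  elim: s => [|a s IHs] hs; first by exists 0%N, [::].
  have [|N [t [tI tJ]]] := IHs; first by move=> b bs; apply: hs; rewrite inE bs orbT.
  have [d [h [Ih sh ha]]] := hs a (mem_head _ _).
  exists (maxn d N), (h :: t); split.
    by move=> k; rewrite inE => /orP[/eqP->|/tI].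
  move=> J idJ htJ b; rewrite inE => /orP[/eqP->|bs].
    apply: (lcS _ d) => //; first exact: leq_maxl.
    by exists h; split=> //; apply: htJ; rewrite mem_head.
  apply: (lcS _ N) => //; first exact: leq_maxr.
  by apply: tJ => // k kt; apply: htJ; rewrite inE kt orbT.
have liftd d : exists t : seq {poly A}, (forall h, h \in t -> I h) /\
    forall J, is_ideal J -> (forall h, h \in t -> J h) -> lc I d `<=` lc J d.
  have [s Ls] := nA _ (lc_ideal _ d idI).
  have : exists t : seq {poly A}, (forall h, h \in t -> I h) /\
    forall J, is_ideal J -> (forall h, h \in t -> J h) -> [set` s] `<=` lc J d.
    have : forall a, a \in s -> lc I d a.
      by rewrite Ls => a as_; apply: (@sub_ideal_gen _ [set` s]).
    elim: s {Ls} => [|a s IHs] hs; first by exists [::].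
    have [|t [tI tJ]] := IHs; first by move=> b bs; apply: hs; rewrite inE bs orbT.
    have [h [Ih sh ha]] := hs a (mem_head _ _).
    exists (h :: t); split; first by move=> k; rewrite inE => /orP[/eqP->|/tI].
    move=> J idJ htJ b /=; rewrite inE => /orP[/eqP->|bs].
      by exists h; split=> //; apply: htJ; rewrite mem_head.
    by apply: tJ => // k kt; apply: htJ; rewrite inE kt orbT.
  case=> t [tI tJ]; exists t; split=> // J idJ htJ.
  by rewrite Ls; apply: ideal_gen_sub; [apply: lc_ideal | apply: tJ].
pose L : set A := [set a | exists d, lc I d a].
have idL : is_ideal L.
  split=> [|x y [d Ix] [e Iy]|a x [d Ix]].
  - by exists 0%N; apply: ideal_0; apply: lc_ideal.
  - exists (maxn d e); apply: ideal_D; first exact: lc_ideal.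
      by apply: lcS Ix => //; apply: leq_maxl.
    by apply: lcS Iy => //; apply: leq_maxr.
  - by exists d; apply: ideal_M => //; apply: lc_ideal.
have [s Ls] := nA _ idL.
have [|N [t [tI tJ]]] := lift s.
  by move=> a as_; have: L a by rewrite Ls; apply: (@sub_ideal_gen _ [set` s]).
have [u [uI uJ]] : exists u : seq {poly A}, (forall h, h \in u -> I h) /\
    forall J, is_ideal J -> (forall h, h \in u -> J h) ->
    forall d, (d < N)%N -> lc I d `<=` lc J d.
  elim: N {tJ} => [|N [u [uI uJ]]]; first by exists [::].
  have [v [vI vJ]] := liftd N; exists (v ++ u); split.
    by move=> h; rewrite mem_cat => /orP[/vI|/uI].
  move=> J idJ vuJ d; rewrite ltnS leq_eqVlt => /orP[/eqP->|dN].
    by apply: vJ => // h hv; apply: vuJ; rewrite mem_cat hv.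
  by apply: uJ => // h hu; apply: vuJ; rewrite mem_cat hu orbT.
exists (t ++ u); apply/seteqP; split; last first.
  apply: ideal_gen_sub => // h /=; rewrite mem_cat => /orP[]; [exact: tI|exact: uI].
set J := ideal_gen _.
have idJ : is_ideal J by apply: ideal_gen_is_ideal.
have lcIJ d : lc I d `<=` lc J d.
  have [dN|Nd] := ltnP d N.
    apply: uJ => // h hu; apply: (@sub_ideal_gen _ [set` t ++ u]) => /=.
    by rewrite mem_cat hu orbT.
  move=> a Ia; have : L a by exists d.
  rewrite Ls; move: a {Ia}; apply: ideal_gen_sub; first exact: lc_ideal.
  move=> a as_; apply: lcS Nd _ _ => //; apply: tJ => // h ht.
  by apply: (@sub_ideal_gen _ [set` t ++ u]) => /=; rewrite mem_cat ht.
suff H d f : I f -> (size f <= d)%N -> J f by move=> f If; apply: (H (size f)).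
elim: d f => [|d IHd] f If sf.
  by move: sf; rewrite leqn0 size_poly_eq0 => /eqP->; apply: ideal_0.
have [|h [Jh sh hf]] := lcIJ d f`_d; first by exists f.
have Ih : I h.
  move: Jh; apply: ideal_gen_sub => // k /=.
  by rewrite mem_cat => /orP[]; [exact: tI|exact: uI].
rewrite -[f](subrK h); apply: (ideal_D idJ) _ Jh; apply: IHd.
  by apply: (ideal_D idI) => //; rewrite -mulN1r; apply: (ideal_M idI).
apply/leq_sizeP => j; rewrite leq_eqVlt => /orP[/eqP<-|dj].
  by rewrite coefB hf subrr.
by rewrite coefB !nth_default ?subr0 // (leq_trans _ dj).
Qed.

Lemma noetherian_fg_algebra (A R : comNzRingType) (f : {rmorphism A -> R})
    (s : seq R) : noetherian A ->
  smallest (@is_subring R) (range f `|` [set` s]) = setT -> noetherian R.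
Proof.
move=> nA genR.
have [B [h [nB fB sB]]] : exists (B : comNzRingType) (h : {rmorphism B -> R}),
    [/\ noetherian B, range f `<=` range h & [set` s] `<=` range h].
  elim: s {genR} => [|x s [B [h [nB fB sB]]]]; first by exists A, f; split=> // y;
    rewrite /= in_nil.
  pose k : {rmorphism {poly B} -> R} := horner_morph (fun b => mulrC x (h b)).
  exists {poly B}, k; split; first exact: noetherian_poly.
    by move=> y /fB[b _ <-]; exists b%:P => //; exact: horner_morphC.
  move=> y /=; rewrite inE => /orP[/eqP->|/sB[b _ <-]].
    by exists 'X => //; exact: horner_morphX.
  by exists b%:P => //; exact: horner_morphC.
apply: (noetherian_image (f := h)) => // y.
suff : [set: R] `<=` range h by move=> /(_ y I)[x _ <-]; exists x.
rewrite -genR; apply: smallest_sub; last by rewrite subUset.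
split=> [|_ _ [a _ <-] [b _ <-]|_ _ [a _ <-] [b _ <-]].
- by exists 1 => //; rewrite rmorph1.
- by exists (a - b) => //; rewrite rmorphB.
- by exists (a * b) => //; rewrite rmorphM.
Qed.

End HilbertBasis.

Section SubgroupQuotient.
Variables (G : zmodType) (S : set G).

Definition is_subgroup (H : set G) : Prop :=
  H 0 /\ forall x y, H x -> H y -> H (x - y).

Definition subgroup_gen : set G := smallest is_subgroup S.

Definition subgroup_pred (x : G) : bool := `[< subgroup_gen x >].

Lemma subgroup_pred_zmod_closed : zmod_closed subgroup_pred.
Proof.
split=> [|x y /asboolP Sx /asboolP Sy]; apply/asboolP => H [sH SH].
  by case: sH.
by apply: sH.2; [apply: Sx | apply: Sy].
Qed.

HB.instance Definition _ :=
  GRing.isZmodClosed.Build G subgroup_pred subgroup_pred_zmod_closed.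

Definition quotg : Type := Quotient.quot (GRing.ZmodClosed.clone G subgroup_pred _).

HB.instance Definition _ := GRing.Zmodule.on quotg.

Definition quotg_pi : {additive G -> quotg} := \pi_quotg.

Lemma quotg_pi_surj (y : quotg) : exists x, quotg_pi x = y.
Proof. by exists (repr y); rewrite /quotg_pi /= reprK. Qed.

Lemma quotg_pi_eq0 x : quotg_pi x = 0 <-> subgroup_gen x.
Proof.
rewrite -(raddf0 quotg_pi) /=; split=> [/eqP|Sx].
  by rewrite -Quotient.idealrBE subr0 => /asboolP.
by apply/eqP; rewrite -Quotient.idealrBE subr0; apply/asboolP.
Qed.

End SubgroupQuotient.

Section DivisorialIdeals.
Variable R : idomainType.
Local Notation F := {fraction R}.
Local Notation "x %:F" := (@FracField.tofrac R x).
Implicit Types (S T I J : set F) (x y z : F).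

Definition integrally_closed : Prop :=
  forall x, integralOver (@FracField.tofrac R) x -> exists r, x = r%:F.

(* S ^-1 = (R : S) *)
Definition colon S : set F :=
  [set x | forall y, S y -> exists r : R, x * y = r%:F].

Definition fractional_ideal I : Prop :=
  [/\ I 0, forall x y, I x -> I y -> I (x + y),
      forall (r : R) x, I x -> I (r%:F * x),
      exists2 x, I x & x != 0
    & exists2 r : R, r != 0 & forall x, I x -> exists s : R, r%:F * x = s%:F].

Definition divisorial I : Prop :=
  fractional_ideal I /\ colon (colon I) = I.

(* The products x * y only generate the product ideal I J, but
   R : (R : _) takes the same value on a set and on the R-module it spans. *)
Definition setprod S T : set F := [set z | exists x y, [/\ S x, T y & z = x * y]].

Definition principal I : Prop :=
  exists2 x, x != 0 & I = range (fun r : R => r%:F * x).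

Lemma colonS S T : S `<=` T -> colon T `<=` colon S.
Proof. by move=> ST x Tx y /ST/Tx. Qed.

Lemma sub_colonK S : S `<=` colon (colon S).
Proof. by move=> x Sx y /(_ x Sx)[r yx]; exists r; rewrite mulrC. Qed.

Lemma colonKK S : colon (colon (colon S)) = colon S.
Proof.
apply/seteqP; split; last exact: sub_colonK.
exact/colonS/sub_colonK.
Qed.

Lemma setprodC S T : setprod S T = setprod T S.
Proof.
by apply/seteqP; split=> _ [x [y [Sx Ty ->]]]; exists y, x; rewrite mulrC.
Qed.

Lemma colon_setprod S T x :
  colon (setprod S T) x <-> forall t, T t -> colon S (x * t).
Proof.
split=> [STx t Tt s Ss|Tx _ [s [t [Ss Tt ->]]]].
  have [|r e] := STx (s * t); first by exists s, t.
  by exists r; rewrite -e -mulrA (mulrC t).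
by have [r e] := Tx t Tt s Ss; exists r; rewrite -e -mulrA (mulrC t).
Qed.

Lemma colon_setprod_l S T :
  colon (setprod (colon (colon S)) T) = colon (setprod S T).
Proof.
by apply/seteqP; split=> x /colon_setprod xST; apply/colon_setprod => t /xST;
  rewrite colonKK.
Qed.

Lemma setprodA S T U : setprod S (setprod T U) = setprod (setprod S T) U.
Proof.
apply/seteqP; split=> z.
  case=> x [_ [Sx [y [u [Ty Uu ->]]] ->]].
  by exists (x * y), u; rewrite mulrA; split=> //; exists x, y.
case=> _ [u [[x [y [Sx Ty ->]]] Uu ->]].
by exists x, (y * u); rewrite mulrA; split=> //; exists y, u.
Qed.

Lemma frac_numden x : exists n d : R, d != 0 /\ x * d%:F = n%:F.
Proof.
elim/quotW: x => x; exists (frac x).1, (frac x).2; split.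
  exact: denom_ratioP.
rewrite !piE; apply/eqmodP; rewrite /= FracField.equivfE.
rewrite /FracField.mulf !numden_Ratio ?oner_neq0 ?mulr1 ?denom_ratioP //=.
by rewrite mulrC.
Qed.

Lemma colon_fractional S :
    (exists2 x, S x & x != 0) -> (exists2 x, colon S x & x != 0) ->
  fractional_ideal (colon S).
Proof.
move=> [x Sx x0] [y Cy y0]; split.
- by move=> z _; exists 0; rewrite mul0r tofrac0.
- move=> u v Cu Cv z Sz; have [r ur] := Cu z Sz; have [s vs] := Cv z Sz.
  by exists (r + s); rewrite mulrDl ur vs tofracD.
- move=> r u Cu z Sz; have [s us] := Cu z Sz.
  by exists (r * s); rewrite -mulrA us tofracM.
- by exists y.
have [n [d [d0 e]]] := frac_numden x.
exists n.
  apply: contra_neq x0 => n0; move/eqP: e; rewrite n0 tofrac0.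
  by rewrite mulf_eq0 tofrac_eq0 (negPf d0) orbF => /eqP.
move=> z /(_ x Sx)[r zx]; exists (r * d).
by rewrite -e mulrC mulrA zx tofracM.
Qed.

Lemma fractional_colon_neq0 I : fractional_ideal I ->
  exists2 x, colon I x & x != 0.
Proof. by case=> _ _ _ _ [r r0 Ir]; exists r%:F; rewrite ?tofrac_eq0. Qed.

Lemma divisorial_colon S : 
    (exists2 x, S x & x != 0) -> (exists2 x, colon S x & x != 0) ->
  divisorial (colon S).
Proof. by move=> S0 C0; split; [exact: colon_fractional | exact: colonKK]. Qed.

Record div_ideal : Type := DivIdeal {
  div_set :> set F;
  div_setP : divisorial div_set }.

Lemma div_ideal_eq (I J : div_ideal) : I = J :> set F -> I = J.
Proof.
case: I J => [I hI] [J hJ] /= e; case: _ / e hJ => hJ.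
by congr DivIdeal; apply: Prop_irrelevance.
Qed.

Lemma div_ideal_neq0 (I : div_ideal) : exists2 x, div_set I x & x != 0.
Proof. by case: I => I [[? ? ? I0 ?] ?]. Qed.

Lemma div_ideal_colon_neq0 (I : div_ideal) : exists2 x, colon I x & x != 0.
Proof. by case: I => I [fI ?]; apply: fractional_colon_neq0. Qed.

Lemma div_ideal_colonK (I : div_ideal) : colon (colon I) = I.
Proof. by case: I => I [? ?]. Qed.

Lemma divisorial_opp (I : div_ideal) : divisorial (colon I).
Proof.
by apply: divisorial_colon;
  [exact: div_ideal_neq0 | exact: div_ideal_colon_neq0].
Qed.

Lemma divisorial_mul (I J : div_ideal) :
  divisorial (colon (colon (setprod I J))).
Proof.
have [x Ix x0] := div_ideal_neq0 I; have [y Jy y0] := div_ideal_neq0 J.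
have [u Iu u0] := div_ideal_colon_neq0 I.
have [v Jv v0] := div_ideal_colon_neq0 J.
apply: divisorial_colon.
  exists (u * v); last by rewrite mulf_neq0.
  move=> _ [a [b [Ia Jb ->]]]; have [r ur] := Iu a Ia; have [s vs] := Jv b Jb.
  by exists (r * s); rewrite mulrACA ur vs tofracM.
by exists (x * y); [apply: sub_colonK; exists x, y | rewrite mulf_neq0].
Qed.

Lemma colon_range1 : colon (range (@FracField.tofrac R)) =
  range (@FracField.tofrac R).
Proof.
apply/seteqP; split=> [x /(_ 1)[|r]|_ [r _ <-] _ [s _ <-]].
- by exists 1 => //; rewrite tofrac1.
- by rewrite mulr1 => ->; exists r.
- by exists (r * s); rewrite tofracM.
Qed.

Lemma divisorial_one : divisorial (range (@FracField.tofrac R)).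
Proof.
rewrite -colon_range1; apply: divisorial_colon; rewrite ?colon_range1;
  by exists 1; rewrite ?oner_neq0 //; exists 1 => //; rewrite tofrac1.
Qed.

Lemma colon_mul_inv I : noetherian R -> integrally_closed -> divisorial I ->
  colon (setprod (colon I) I) = range (@FracField.tofrac R).
Proof.
move=> nR icR divI.
pose DI := DivIdeal divI.
have [J0 JD JM [b Jb b0] [c c0 Jc]] := (divisorial_opp DI).1.
rewrite -/(div_set DI) in J0 JD JM Jb Jc *; set J := colon _ in J0 JD JM Jb Jc *.
apply/seteqP; split=> [x xJI|_ [r _ <-] _ [y [z [Jy Iz ->]]]]; last first.
  by have [s e] := Jy z Iz; exists (r * s); rewrite e tofracM.
have xJ y : J y -> J (x * y).
  move=> Jy z Iz; have [|r e] := xJI (y * z); first by exists y, z.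
  by exists r; rewrite -mulrA.
have idcJ : is_ideal [set r : R | exists2 y, J y & c%:F * y = r%:F].
  split=> [|r s [y Jy e] [z Jz e']|r s [y Jy e]].
  - by exists 0 => //; rewrite mulr0 tofrac0.
  - by exists (y + z); [exact: JD | rewrite mulrDr e e' tofracD].
  - by exists (r%:F * y); [exact: JM | rewrite mulrCA e tofracM].
have [s sJ] := nR _ idcJ.
have cF0 : c%:F != 0 by rewrite tofrac_eq0.
have spanJ y : J y -> exists a : 'I_(size s) -> R,
    c%:F * y = \sum_i (a i)%:F * (s`_i)%:F.
  move=> Jy; have [r e] := Jc y Jy.
  have : ideal_gen [set` s] r by rewrite -sJ; exists y.
  pose K : set R := [set r | exists a : 'I_(size s) -> R, r = \sum_i a i * s`_i].
  have sK : ideal_gen [set` s] `<=` K.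
    apply: ideal_gen_sub.
      split=> [|u v [a ->] [a' ->]|t u [a ->]].
      - by exists (fun=> 0); rewrite big1 // => i _; rewrite mul0r.
      - exists (fun i => a i + a' i); rewrite -big_split /=.
        by apply: eq_bigr => i _; rewrite mulrDl.
      - exists (fun i => t * a i); rewrite mulr_sumr.
        by apply: eq_bigr => i _; rewrite mulrA.
    move=> u /= us; have lt_us : (index u s < size s)%N by rewrite index_mem.
    exists (fun i => (i == Ordinal lt_us)%:R).
    rewrite (bigD1 (Ordinal lt_us)) //= eqxx mul1r nth_index // big1 ?addr0 //.
    by move=> i /negPf ->; rewrite mul0r.
  case/sK=> a ra; exists a; rewrite e ra rmorph_sum.
  by apply: eq_bigr => i _; rewrite rmorphM.
have sgen i : exists2 y, J y & c%:F * y = (s`_i)%:F.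
  have [lt_i|ge_i] := ltnP i (size s); last first.
    by exists 0; rewrite // mulr0 nth_default.
  suff: ideal_gen [set` s] s`_i by rewrite -sJ.
  by apply: (@sub_ideal_gen _ [set` s]); rewrite /= mem_nth.
have /fin_all_exists[M eM] (i : 'I_(size s)) : exists m : {ffun 'I_(size s) -> R},
    x * (s`_i)%:F = \sum_j (m j)%:F * (s`_j)%:F.
  have [y Jy <-] := sgen i; have [a e] := spanJ _ (xJ _ Jy).
  by exists (finfun a); rewrite mulrCA e; apply: eq_bigr => j _; rewrite ffunE.
pose A : 'M[R]_(size s) := \matrix_(i, j) M j i.
pose g : 'rV[F]_(size s) := \row_i (s`_i)%:F.
have gA : g *m map_mx (@FracField.tofrac R) A = x *: g.
  apply/rowP => i; rewrite !mxE eM; apply: eq_bigr => j _.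
  by rewrite !mxE mulrC.
have g0 : g != 0.
  apply/eqP => g0; have [a e] := spanJ _ Jb.
  have /eqP : c%:F * b = 0.
    rewrite e big1 // => i _; have /rowP/(_ i) := g0.
    by rewrite !mxE => ->; rewrite mulr0.
  by rewrite mulf_eq0 (negPf cF0) (negPf b0).
have [r ->] : exists r, x = r%:F; last by exists r.
apply: icR; exists (char_poly A); first exact: char_poly_monic.
by rewrite map_char_poly -eigenvalue_root_char; apply/eigenvalueP; exists g.
Qed.

End DivisorialIdeals.

(* The group law on div_ideal R needs both hypotheses, hence the type carries
   them. *)
Definition Div (R : idomainType) (nR : noetherian R)
  (icR : integrally_closed R) : Type := div_ideal R.

Section ClassGroup.
Variables (R : idomainType) (nR : noetherian R) (icR : integrally_closed R).

Local Notation Div := (Div nR icR).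

HB.instance Definition _ := gen_eqMixin Div.
HB.instance Definition _ := gen_choiceMixin Div.

Definition div_zero : Div := DivIdeal (divisorial_one R).
Definition div_opp (I : Div) : Div := DivIdeal (divisorial_opp I).
Definition div_add (I J : Div) : Div := DivIdeal (divisorial_mul I J).

Lemma div_addA : associative div_add.
Proof.
move=> I J K; apply: div_ideal_eq => /=; congr colon.
by rewrite (setprodC I) !colon_setprod_l -[in RHS]setprodA (setprodC I).
Qed.

Lemma div_addC : commutative div_add.
Proof. by move=> I J; apply: div_ideal_eq => /=; rewrite setprodC. Qed.

Lemma div_add0 : left_id div_zero div_add.
Proof.
move=> I; apply: div_ideal_eq => /=; rewrite -[RHS]div_ideal_colonK.
congr (colon (colon _)); apply/seteqP; split.
  by have [[_ _ IM _ _] _] := div_setP I => _ [_ [x [[r _ <-] Ix ->]]]; exact: IM.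
by move=> x Ix; exists 1, x; rewrite mul1r; split=> //; exists 1; rewrite ?tofrac1.
Qed.

Lemma div_addN : left_inverse div_zero div_opp div_add.
Proof.
move=> I; apply: div_ideal_eq => /=.
by rewrite colon_mul_inv ?colon_range1 //; apply: div_setP.
Qed.

HB.instance Definition _ :=
  GRing.isZmodule.Build Div div_addA div_addC div_add0 div_addN.

Definition Cl : Type := quotg [set I : Div | principal I].

HB.instance Definition _ := GRing.Zmodule.on Cl.

Definition Cl_class : {additive Div -> Cl} := @quotg_pi _ _.

End ClassGroup.

Arguments Cl_class {R nR icR}.

Section Dimension.
Variable A : comNzRingType.
Implicit Types (I P : set A).

Definition prime_chain (n : nat) (p : nat -> set A) : Prop :=
  (forall i, (i <= n)%N -> prime_ideal (p i)) /\
  (forall i, (i < n)%N -> p i `<` p i.+1).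

Definition krull_dim (n : nat) : Prop :=
  is_max (fun k => exists p, prime_chain k p) n.

Definition height P (n : nat) : Prop :=
  is_max (fun k => exists p, prime_chain k p /\ p k = P) n.

Definition regular_seq (s : seq A) : Prop :=
  (forall i, (i < size s)%N -> forall x,
     ideal_gen [set` take i s] (s`_i * x) -> ideal_gen [set` take i s] x) /\
  ~ ideal_gen [set` s] 1.

Definition depth I (n : nat) : Prop :=
  is_max (fun k => exists s, [/\ regular_seq s, [set` s] `<=` I & size s = k]) n.

(* depth(P, R) = height(P) at every maximal ideal P. *)
Definition cohen_macaulay : Prop :=
  noetherian A /\
  forall P, maximal_ideal P -> exists n, height P n /\ depth P n.

End Dimension.

Definition direct_sum_of (I : eqType) (V : zmodType) (D : I -> set V) : Prop :=
  [/\ forall i, is_subgroup (D i),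
      forall x, exists (s : seq I) (c : I -> V),
        (forall i, D i (c i)) /\ x = \sum_(i <- s) c i
    & forall (s : seq I) (c : I -> V), uniq s -> (forall i, D i (c i)) ->
        \sum_(i <- s) c i = 0 -> forall i, i \in s -> c i = 0].

Record graded_algebra (K : fieldType) (R : comNzRingType)
    (iota : {rmorphism K -> R}) (g : nat -> set R) : Prop := GradedAlgebra {
  graded_direct : direct_sum_of g;
  graded_mul : forall i j x y, g i x -> g j y -> g (i + j)%N (x * y);
  graded_zero : g 0%N = range iota;
  graded_fg : exists s : seq R,
    smallest (@is_subring R) (range iota `|` [set` s]) = setT }.

Definition irrelevant_ideal (R : comNzRingType) (g : nat -> set R) : set R :=
  ideal_gen [set x | exists2 i, (0 < i)%N & g i x].

Definition int_grading (R : comNzRingType) (g : nat -> set R) (j : int) : set R :=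
  match j with Posz n => g n | Negz _ => [set 0] end.

Definition local_ring (R : comNzRingType) (m : set R) : Prop :=
  maximal_ideal m /\ forall m', maximal_ideal m' -> m' = m.

Inductive setting (R : idomainType) : Type :=
| LocalRing (m : set R) of noetherian R & local_ring m
| GradedAlg (K : fieldType) (iota : {rmorphism K -> R}) (g : nat -> set R)
    of graded_algebra iota g.

Lemma setting_noetherian (R : idomainType) (S : setting R) : noetherian R.
Proof.
case: S => [//|K iota g [_ _ _ [s gens]]].
exact: noetherian_fg_algebra (@noetherian_field K) gens.
Qed.

Section CanonicalModule.
Variable R : comNzRingType.

(* ... -> R^(rk 1) -> R^(rk 0) -> R / m -> 0: vectors are rows, the maps are
   right multiplication by dif i, and the augmentation is v |-> v *m aug mod m. *)
Record free_complex : Type := FreeComplex {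
  rk : nat -> nat;
  dif : forall i, 'M[R]_(rk i.+1, rk i);
  aug : 'cV[R]_(rk 0) }.

Definition resolves (m : set R) (F : free_complex) : Prop :=
  [/\ forall x, exists v : 'rV_(rk F 0), m ((v *m aug F) 0 0 - x),
      forall v : 'rV_(rk F 0), m ((v *m aug F) 0 0) <-> exists w, v = w *m dif F 0
    & forall i (v : 'rV_(rk F i.+1)),
        v *m dif F i = 0 <-> exists w, v = w *m dif F i.+1].

Section Ext.
Variables (F : free_complex) (C : lmodType R).

(* A cochain is an R-linear map R^(rk i) -> C given on the standard basis. *)
Definition cochain (i : nat) := 'I_(rk F i) -> C.

Definition cobound i (c : cochain i) : cochain i.+1 :=
  fun j => \sum_k dif F i j k *: c k.

Definition is_cocycle i (c : cochain i) : Prop := forall j, cobound c j = 0.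

Definition is_coboundary i : cochain i -> Prop :=
  match i with
  | 0%N => fun c => forall j, c j = 0
  | i'.+1 => fun c => exists b : cochain i', forall j, c j = cobound b j
  end.

Definition ext_eq0 (i : nat) : Prop :=
  forall c : cochain i, is_cocycle c -> is_coboundary c.

(* 1 |-> [z] induces an isomorphism R / m -> Ext^i(R / m, C). *)
Definition ext_residue_iso (m : set R) i (z : cochain i) : Prop :=
  [/\ is_cocycle z,
      forall c : cochain i, is_cocycle c ->
        exists r : R, is_coboundary (fun j => c j - r *: z j)
    & forall r : R, is_coboundary (fun j => r *: z j) <-> m r].

End Ext.

Definition fg_module (C : lmodType R) : Prop :=
  exists n (u : 'I_n -> C), forall x, exists c : 'I_n -> R, x = \sum_i c i *: u i.

(* Ext^i(R / m, C) is R / m for i = dim R and 0 otherwise. Ext is computed from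
   a resolution of R / m by free modules of finite rank, and does not depend on
   its choice. *)
Definition local_canonical (m : set R) (C : lmodType R) : Prop :=
  fg_module C /\
  exists (d : nat) (F : free_complex),
    [/\ krull_dim R d, resolves m F,
        forall i, i <> d -> ext_eq0 F C i
      & exists z : cochain F C d, ext_residue_iso m z].

Definition graded_module (g : nat -> set R) (C : lmodType R)
    (D : int -> set C) : Prop :=
  direct_sum_of D /\
  forall (i : nat) (j : int) (a : R) x, g i a -> D j x -> D (i%:Z + j) (a *: x).

(* The k-th basis vector of the i-th free module has degree deg i k, and all
   maps of the complex have degree 0. *)
Definition homogeneous_complex (g : nat -> set R) (F : free_complex)
    (deg : forall i, 'I_(rk F i) -> int) : Prop :=
  (forall i j k, int_grading g (deg i.+1 j - deg i k) (dif F i j k)) /\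
  (forall k, int_grading g (deg 0%N k) (aug F k 0)).

(* The isomorphism of R / m with Ext^d is homogeneous of degree 0, as its
   generating cocycle is a homogeneous map of degree 0. *)
Definition graded_canonical (g : nat -> set R) (C : lmodType R) : Prop :=
  fg_module C /\
  exists (D : int -> set C) (d : nat) (F : free_complex)
      (deg : forall i, 'I_(rk F i) -> int),
    [/\ graded_module g D, krull_dim R d,
        resolves (irrelevant_ideal g) F /\ homogeneous_complex g deg,
        forall i, i <> d -> ext_eq0 F C i
      & exists2 z : cochain F C d, ext_residue_iso (irrelevant_ideal g) z &
          forall k, D (deg d k) (z k)].

End CanonicalModule.

Definition canonical_module (R : idomainType) (S : setting R)
    (C : lmodType R) : Prop :=
  match S with
  | LocalRing m _ _ => local_canonical m C
  | GradedAlg _ _ g _ => graded_canonical g C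
  end.

(* I is a fractional ideal isomorphic to C as an R-module. *)
Definition module_iso_ideal (R : idomainType) (C : lmodType R)
    (I : set {fraction R}) : Prop :=
  exists f : {additive C -> {fraction R}},
    [/\ forall (r : R) x, f (r *: x) = FracField.tofrac r * f x,
        injective f & range f = I].

Section AbelianGroups.
Variable G : zmodType.

Definition zcomb n (u : 'I_n -> G) (c : 'rV[int]_n) : G := \sum_i u i *~ c 0 i.

Definition zfree n (u : 'I_n -> G) : Prop := forall c, zcomb u c = 0 -> c = 0.

Definition zbasis n (u : 'I_n -> G) : Prop :=
  zfree u /\ forall x, exists c, x = zcomb u c.

Definition part_of_basis (w : G) : Prop :=
  exists n (u : 'I_n -> G), zbasis u /\ exists i, u i = w.

Definition zrank : nat :=
  xget 0%N [set n | is_max (fun k => exists u : 'I_k -> G, zfree u) n].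

(* The rows of A span the relations among the generators u. *)
Definition presents m n (u : 'I_n -> G) (A : 'M[int]_(m, n)) : Prop :=
  (forall x, exists c, x = zcomb u c) /\
  (forall c, zcomb u c = 0 <-> exists b : 'rV_m, c = b *m A).

End AbelianGroups.

Definition minors_ideal m n (k : nat) (A : 'M[int]_(m, n)) : set int :=
  ideal_gen [set x | exists (f : 'I_k -> 'I_m) (h : 'I_k -> 'I_n),
    [/\ {homo f : i j / (i < j)%N}, {homo h : i j / (i < j)%N}
      & x = \det (mxsub f h A)]].

(* For i >= n the truncated difference n - i is 0, and the empty minor is 1. *)
Definition fitt (G : zmodType) (i : nat) : set int :=
  [set x | exists m n (u : 'I_n -> G) (A : 'M[int]_(m, n)),
    presents u A /\ minors_ideal (n - i) A x].

Definition cyc_quot (G : zmodType) (w : G) : zmodType := quotg [set w].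

(* This is d(R) for G = Cl(R) and w = [omega_R]. *)
Definition torsion_number (G : zmodType) (w : G) : nat :=
  let rho := zrank (cyc_quot w) in
  if `[< fitt G rho = fitt (cyc_quot w) rho >] then 0%N
  else xget 0%N [set d : nat | fitt (cyc_quot w) rho = ideal_gen [set d%:Z]].

Definition reduced_Cl (R : idomainType) (nR : noetherian R)
    (icR : integrally_closed R) (W : Div nR icR) : zmodType :=
  cyc_quot (Cl_class W).

Definition zmod_isomorphic (G H : zmodType) : Prop :=
  exists f : {additive G -> H}, bijective f.

(* Main.v *)
Require Import Defs.
From HB Require Import structures.
From mathcomp Require Import all_boot all_order all_algebra.
From mathcomp Require Import boolp classical_sets.
Import GRing.Theory.
Local Open Scope classical_set_scope.
Local Open Scope ring_scope.

Set Implicit Arguments.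
Unset Strict Implicit.
Unset Printing Implicit Defensive.

(** The question is about the element [w = [omega_R]] of the free abelian group
    [G = Cl(R)] of rank [r = s + 1], with coordinates [phi : G -> Z^r].

    By the Smith normal form of the row vector [phi w], coordinates on [G] can
    be chosen in which [w = (d, 0, ..., 0)] with [d] the gcd of the coordinates
    of [phi w] ([adapted_coordinates]).  In these coordinates [G / Zw] is
    visibly [Z^s x Z/d] ([cyc_quot_iso]), and [w] belongs to a basis exactly
    when [d = 1] ([part_of_basisE]): if [w], which is [d] times an element,
    is a basis vector, then [d] divides 1.

    It remains to identify [d] with the torsion number ([torsion_numberE]).
    If [d = 0] then [w = 0], the groups [G] and [G / Zw] are isomorphic, and
    their Fitting ideals agree, so the torsion number is 0.  If [d > 0] then
    [G / Zw] has rank [s], and the claim is that Fitt_s is [0] for [G] and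
    [(d)] for [G / Zw].  The generators given by the coordinates, with [w] as
    the only relation, show that [d] lies in Fitt_s(G / Zw).  The upper
    bounds must hold for every presentation; both come from one principle
    ([fitt_vanish]): if the standard basis of [R^r] lies in the image of an
    additive map [H -> R^r], for a commutative ring [R], then Fitt_i(H) dies
    in [R] for all [i < r].  It is applied to [G -> Z^(s+1)] and to
    [G / Zw -> (Z/d)^(s+1)]. *)

(** * Minors of relation matrices *)

(** Such a product is also a product of square matrices, after padding [X] with
    zero columns and [Y] with zero rows.  A rank argument would fail over a ring
    with zero divisors. *)
Lemma det_mulmx_thin (R : comNzRingType) N n (X : 'M[R]_(N, n)) (Y : 'M_(n, N)) :
  (n < N)%N -> \det (X *m Y) = 0.
Proof.
move=> ltnN; have [p NE] : exists p, N = (n + p.+1)%N.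
  by exists (N - n.+1)%N; rewrite addnS -addSn subnKC.
subst N.
have -> : X *m Y = row_mx X 0 *m col_mx Y (0 : 'M_(p.+1, _)).
  by rewrite mul_row_col mul0mx addr0.
rewrite det_mulmx (expand_det_col _ (rshift n ord0)) big1 ?mul0r // => i _.
by rewrite row_mxEr mxE mul0r.
Qed.

(** Over a field this says that [A] has rank at most [n - r].  Over a ring,
    let [F] and [E] be the matrices that select the rows [f] and the columns
    [h]: the square matrix [(F A; C) (E | B)] of size [k + r] is block
    triangular with diagonal blocks the minor and the identity, and it factors
    through dimension [n < k + r]. *)
Lemma minor_eq0 (R : comNzRingType) m n r k (A : 'M[R]_(m, n))
    (B : 'M_(n, r)) (C : 'M_(r, n)) (f : 'I_k -> 'I_m) (h : 'I_k -> 'I_n) :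
  (n < k + r)%N -> A *m B = 0 -> C *m B = 1%:M -> \det (mxsub f h A) = 0.
Proof.
move=> ltn AB CB.
have := det_mulmx_thin (col_mx (rowsub f A) C)
  (row_mx (colsub h 1%:M) B) ltn.
rewrite mul_col_row (mul_rowsub_mx f A B) AB CB.
have -> : rowsub f A *m colsub h 1%:M = mxsub f h A.
  by rewrite mulmx_colsub mulmx1; apply/matrixP => i j; rewrite !mxE.
have -> : rowsub f (0 : 'M[R]_(m, r)) = 0 by apply/matrixP => i j; rewrite !mxE.
by rewrite det_lblock det1 mulr1.
Qed.

(** * Integral combinations and quotients by a cyclic subgroup *)

Definition additive_of (U V : zmodType) (f : U -> V)
  (fB : {morph f : x y / x - y}) : {additive U -> V} :=
  HB.pack f (GRing.isZmodMorphism.Build U V f fB).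

Section IntegralCombinations.
Variables (G H : zmodType) (f : {additive G -> H}).

Lemma raddf_zcomb n (u : 'I_n -> G) c : f (zcomb u c) = zcomb (f \o u) c.
Proof. by rewrite /zcomb raddf_sum; apply: eq_bigr => i _; rewrite raddfMz. Qed.

Lemma zcombB n (u : 'I_n -> G) : {morph zcomb u : c e / c - e}.
Proof.
move=> c e; rewrite /zcomb -sumrB; apply: eq_bigr => i _.
by rewrite !mxE mulrzBr.
Qed.

Lemma zcombMz n (u : 'I_n -> G) c (t : int) : zcomb u (t *: c) = zcomb u c *~ t.
Proof.
rewrite /zcomb mulrz_suml; apply: eq_bigr => i _.
by rewrite !mxE mulrC mulrzA.
Qed.

Lemma zcomb_delta n (u : 'I_n -> G) i : zcomb u (delta_mx 0 i) = u i.
Proof.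
rewrite /zcomb (bigD1 i) //= mxE !eqxx big1 ?addr0 // => j /negPf ji.
by rewrite mxE ji andbF.
Qed.

End IntegralCombinations.

Lemma zcomb_deltas n (c : 'rV[int]_n) : zcomb (fun i => delta_mx 0 i) c = c.
Proof.
rewrite [RHS]row_sum_delta; apply: eq_bigr => i _.
by rewrite -scaler_int intz.
Qed.

Lemma zcomb_coordinates (G : zmodType) n (psi : {additive G -> 'rV[int]_n})
    (psi' : 'rV[int]_n -> G) (c : 'rV[int]_n) : cancel psi' psi ->
  psi (zcomb (fun i => psi' (delta_mx 0 i)) c) = c.
Proof.
move=> psi'K; rewrite raddf_zcomb -[RHS]zcomb_deltas.
by apply: eq_bigr => i _; rewrite /= psi'K.
Qed.

(** The integral coefficients are mapped to [R], which is to be [Z] or [Z/d]; so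
    an integral relation between vectors becomes a matrix equation over [R]. *)
Lemma zcomb_rV (R : comNzRingType) n r (v : 'I_n -> 'rV[R]_r) (c : 'rV[int]_n) :
  zcomb v c = map_mx intr c *m \matrix_i v i.
Proof.
rewrite mulmx_sum_row; apply: eq_bigr => i _.
by rewrite rowK mxE scaler_int.
Qed.

Section CyclicQuotient.
Variables (G : zmodType) (w : G).
Notation pi := (@quotg_pi G [set w]).

Lemma cyc_quot_pi_eq0 x : pi x = 0 <-> exists t : int, x = w *~ t.
Proof.
rewrite quotg_pi_eq0; split=> [Sx|[t ->] H [[H0 HB] /(_ w erefl) Hw]].
  apply: (Sx [set x | exists t : int, x = w *~ t]).
  split; last by move=> _ ->; exists 1.
  split=> [|_ _ [a ->] [b ->]]; first by exists 0.
  by exists (a - b); rewrite mulrzBr.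
have HN y : H y -> H (- y) by move=> Hy; rewrite -sub0r; apply: HB.
have Hn n : H (w *+ n).
  elim: n => [|n IHn]; rewrite ?mulr0n // mulrSr -[X in _ + X]opprK.
  by apply: HB => //; apply: HN.
by case: t => n; rewrite ?NegzE ?mulrNz; [apply: Hn | apply/HN/Hn].
Qed.

Lemma cyc_quot_pi_gen : pi w = 0.
Proof. by apply/cyc_quot_pi_eq0; exists 1. Qed.

(** The induced map is read off on the representatives chosen by [repr], on
    which [f] is independent of the choice. *)
Lemma cyc_quot_lift (H : zmodType) (f : {additive G -> H}) : f w = 0 ->
  exists g : {additive cyc_quot w -> H}, forall x, g (pi x) = f x.
Proof.
move=> fw.
have fpi x y : pi x = pi y -> f x = f y.
  move=> xy; apply/eqP; rewrite -subr_eq0 -raddfB.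
  have [|t ->] := (cyc_quot_pi_eq0 (x - y)).1; first by rewrite raddfB xy subrr.
  by rewrite raddfMz fw mul0rz.
pose g (y : cyc_quot w) := f (repr y).
have piK y : pi (repr y) = y by exact: reprK.
have gpi x : g (pi x) = f x by apply: fpi; rewrite piK.
have gB : {morph g : x y / x - y}.
  by move=> x y; rewrite -[x in LHS]piK -[y in LHS]piK -raddfB gpi raddfB.
by exists (additive_of gB).
Qed.

End CyclicQuotient.

Lemma additive_bij (G H : zmodType) (f : {additive G -> H}) :
  (forall x, f x = 0 -> x = 0) -> (forall y, exists x, f x = y) -> bijective f.
Proof.
move=> f0 /choice[g gK]; exists g => // x; apply/eqP.
by rewrite -subr_eq0; apply/eqP/f0; rewrite raddfB gK subrr.
Qed.

(** * Rank *)

(** In the Smith form [L D R] of the matrix with rows [v i], the last row of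
    [D] vanishes as there are more rows than columns; hence the last row of
    [L^-1] gives a relation. *)
Lemma zcomb_dependent k s (v : 'I_k -> 'rV[int]_s) : (s < k)%N ->
  exists2 c, c != 0 & zcomb v c = 0.
Proof.
case: k v => // k v; rewrite ltnS => lesk.
have [L Lu [R _ [d _ vE]]] := int_Smith_normal_form (\matrix_i v i).
exists (delta_mx 0 ord_max *m invmx L).
  apply/eqP => /(congr1 (mulmx^~ L)); rewrite mulmxKV // mul0mx.
  by move=> /rowP/(_ ord_max)/eqP; rewrite !mxE !eqxx.
rewrite zcomb_rV map_mx_id; last exact: intz.
rewrite vE -mulmxA !mulmxA mulmxKV // -rowE.
suff -> : row ord_max (\matrix_(i < k.+1, j < s) (d`_i *+ (i == j :> nat))) = 0
  by rewrite mul0mx.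
by apply/rowP => j; rewrite !mxE gtn_eqF // (leq_trans (ltn_ord j)).
Qed.

(** The rank does not see a kernel killed by [d]: a relation between the images
    of elements of [H] becomes, multiplied by [d], a relation in [H]. *)
Lemma zrank_torsion_kernel (H : zmodType) s (p : {additive H -> 'rV[int]_s})
    (d : nat) : (0 < d)%N -> (forall y, exists x, p x = y) ->
  (forall x, p x = 0 -> x *+ d = 0) -> zrank H = s.
Proof.
move=> d0 ps pk.
have maxs : is_max (fun k => exists u : 'I_k -> H, zfree u) s.
  split=> [|k [u fu]].
    have /choice[u uP] (i : 'I_s) : exists x, p x = delta_mx 0 i by exact: ps.
    exists u => c /(congr1 p); rewrite raddf_zcomb raddf0 => <-.
    by rewrite -[LHS]zcomb_deltas; apply: eq_bigr => i _; rewrite /= uP.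
  rewrite leqNgt; apply/negP => /(zcomb_dependent (p \o u))[c /eqP c0 pc].
  case: c0; rewrite -raddf_zcomb in pc.
  have /rowP dc : d%:Z *: c = 0 by apply: fu; rewrite zcombMz -pmulrn pk.
  apply/rowP => i; have /eqP := dc i.
  by rewrite !mxE mulf_eq0 => /orP[|/eqP//]; case: (d) d0.
apply: xget_unique => // k [fk maxk]; apply/eqP.
by rewrite eqn_leq (maxs.2 _ fk) (maxk _ maxs.1).
Qed.

(** * Fitting ideals *)

(** In any presentation, [p] kills the relations and sends the generators to
    vectors that span [R^r]; so [minor_eq0] applies over [R] to the relation
    matrix, and as [i < r] its minors of size [n - i] vanish there. *)
Lemma fitt_vanish (R : comNzRingType) (H : zmodType) r
    (p : {additive H -> 'rV[R]_r}) i (x : int) :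
  (forall j, exists y, p y = delta_mx 0 j) -> (i < r)%N ->
  fitt H i x -> x%:~R = 0 :> R.
Proof.
move=> ps lir [m [n [u [A [[gen rel]]]]]].
suff sub : minors_ideal (n - i) A `<=` [set x : int | x%:~R = 0 :> R] by move/sub.
apply: ideal_gen_sub.
  split=> [|y z /= y0 z0|y z /= z0] //=; first by rewrite intrD y0 z0 addr0.
  by rewrite intrM z0 mulr0.
move=> _ [f [h [_ _ ->]]] /=.
(* [B] lists the images of the generators; [C] expresses preimages of the
   standard basis in terms of the generators, so that [C B = 1], while
   [A B = 0] because the rows of [A] are relations. *)
have /choice[c cP] (j : 'I_r) : exists c, p (zcomb u c) = delta_mx 0 j.
  by have [y <-] := ps j; have [c ->] := gen y; exists c.
rewrite -det_map_mx map_mxsub.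
apply: (minor_eq0 (B := \matrix_j p (u j)) (C := map_mx intr (\matrix_j c j))).
- by rewrite (@leq_ltn_trans (n - i + i)) ?ltn_add2l // addnC -leq_subLR.
- apply/row_matrixP => j; rewrite row_mul -map_row row0 -zcomb_rV.
  rewrite -[RHS](raddf0 p) -[LHS](raddf_zcomb p); congr (p _).
  by apply/rel; exists (delta_mx 0 j); rewrite rowE.
- apply/row_matrixP => j; rewrite row_mul -map_row row1 -zcomb_rV rowK.
  by rewrite -[LHS](raddf_zcomb p) cP.
Qed.

Lemma fitt_iso (G H : zmodType) (f : {additive G -> H}) i :
  bijective f -> fitt G i = fitt H i.
Proof.
have sub (U V : zmodType) (k : {additive U -> V}) :
    bijective k -> fitt U i `<=` fitt V i.
  move=> [k' kK k'K] x [m [n [u [A [[gen rel] xA]]]]].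
  exists m, n, (k \o u), A; split=> //; split=> [y|c].
    by have [c yc] := gen (k' y); exists c; rewrite -raddf_zcomb -yc k'K.
  rewrite -rel -raddf_zcomb -[X in _ = X <-> _](raddf0 k).
  by split=> [/(can_inj kK)|->].
move=> bf; apply/seteqP; split; first exact: sub bf.
case: (bf) => g fK gK; apply: (sub _ _ (additive_of (can2_additive fK gK))).
by exists f.
Qed.

Lemma ideal_gen_int (d : nat) (x : int) :
  ideal_gen [set d%:Z] x <-> (d %| x)%Z.
Proof.
split=> [|/dvdzP[q ->]].
  apply: (@ideal_gen_sub _ _ (fun x => (d %| x)%Z)) => [|_ ->] //=.
  by split=> [|y z dy dz|y z dz] /=; rewrite ?dvdz0 ?dvdz_mull ?rpredD.
by apply: (ideal_M (ideal_gen_is_ideal _)); apply: sub_ideal_gen.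
Qed.

Lemma intr_Zp_eq0 (d : nat) (x : int) : (1 < d)%N ->
  x%:~R = 0 :> 'Z_d -> (d %| x)%Z.
Proof.
move=> d1.
have natP (n : nat) : n%:R = 0 :> 'Z_d -> (d %| n)%N.
  by move=> /(congr1 val) /=; rewrite val_Zp_nat // => /eqP.
case: x => n; rewrite ?NegzE dvdzE ?abszN //=; first exact: natP.
by rewrite mulrNz => /eqP; rewrite oppr_eq0 => /eqP /natP.
Qed.

(** * Coordinates adapted to an element *)

(** The Smith form gives such a [P] with a signed entry in the corner.  That
    entry and the gcd of [v] divide each other since [P] is invertible. *)
Lemma gcd_coordinates s (v : 'rV[int]_s.+1) : exists2 P : 'M[int]_s.+1,
  P \in unitmx & v *m P = delta_mx 0 0 *+ \big[gcdn/0%N]_i `|v 0%R i|%N.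
Proof.
have [L _ [R Ru [d _ vE]]] := int_Smith_normal_form v.
pose e := L 0 0 * d`_0.
(* The sign makes the corner entry of [v *m P] nonnegative. *)
pose P := (-1) ^+ (e < 0)%R *: invmx R.
have Pu : P \in unitmx by rewrite unitmxZ ?unitmx_inv // unitrX ?unitrN1.
have vP : v *m P = `|e|%N%:Z *: delta_mx 0 0.
  rewrite vE -scalemxAr mulmxK //; apply/rowP => j.
  rewrite !mxE big_ord1 !mxE abszE [in RHS]Num.Theory.normrEsign -mulrA; congr (_ * _).
  by rewrite eq_sym mulr_natr /e mulrnAr.
exists P => //; rewrite vP -scaler_nat natz; congr (_%:Z *: _).
apply/eqP; rewrite eqn_dvd; apply/andP; split.
  apply/dvdn_biggcdP => i _; rewrite -[v](mulmxK Pu) vP -scalemxAl mxE.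
  by rewrite [X in (_ %| X)%N]abszM dvdn_mulr.
have -> : `|e|%N = `|(v *m P) 0%R 0%R|%N by rewrite vP !mxE mulr1.
rewrite -[\big[_/_]_i _]absz_nat -dvdzE mxE.
apply: rpred_sum => j _; apply: dvdz_mulr; rewrite dvdzE.
exact: (biggcdn_inf j).
Qed.

Lemma adapted_coordinates (G : zmodType) s (phi : {additive G -> 'rV[int]_s.+1})
    (w : G) : bijective phi ->
  exists2 psi : {additive G -> 'rV[int]_s.+1}, bijective psi
    & psi w = delta_mx 0 0 *+ \big[gcdn/0%N]_i `|phi w 0%R i|%N.
Proof.
move=> phi_bij; have [P Pu <-] := gcd_coordinates (phi w).
have fB : {morph (fun x => phi x *m P) : x y / x - y}.
  by move=> x y; rewrite raddfB mulmxBl.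
exists (additive_of fB) => //.
apply: (bij_comp (f := mulmx^~ P)) => //.
by exists (mulmx^~ (invmx P)) => x; rewrite ?mulmxK ?mulmxKV.
Qed.

(** * The quotient by an element [(d, 0, ..., 0)] of a free group *)

Section AdaptedCyclicQuotient.
Variables (G : zmodType) (w : G) (s d : nat) (psi : {additive G -> 'rV[int]_s.+1}).
Hypotheses (psi_bij : bijective psi) (psi_w : psi w = delta_mx 0 0 *+ d).
Notation pi := (@quotg_pi G [set w]).

Lemma delta_mxMn00 : (delta_mx 0 0 *+ d : 'rV[int]_s.+1) 0 0 = d%:Z.
Proof. by rewrite mulmxnE mxE !eqxx [_ *+ d]natz. Qed.

(** The first coordinate of [G] is read modulo [d], the others are kept. *)
Lemma cyc_quot_iso : exists f : {additive cyc_quot w ->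
  ('rV[int]_s * cyc_quot d%:Z)%type}, bijective f.
Proof.
pose h x : 'rV[int]_s * cyc_quot d%:Z :=
  (rsubmx (psi x : 'rV_(1 + s)), quotg_pi [set d%:Z] (psi x 0 0)).
have hB : {morph h : x y / x - y}.
  move=> x y; rewrite /h raddfB; congr (_, _).
    exact: (raddfB (@rsubmx int 1 1 s)).
  by rewrite !mxE raddfB.
have rsub_w t : rsubmx (psi (w *~ t) : 'rV_(1 + s)) = 0.
  rewrite raddfMz psi_w; apply/rowP => j; rewrite mxE -scaler_int.
  by rewrite !mxE mulmxnE mxE mul0rn mulr0.
have hw : h w = 0.
  congr (_, _); first exact: rsub_w 1.
  rewrite psi_w delta_mxMn00; exact: cyc_quot_pi_gen.
have [f fpi] := cyc_quot_lift (f := additive_of hB) hw.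
exists f; apply: additive_bij => [y|[v y]].
  have [x <-] := quotg_pi_surj y; rewrite fpi => -[hv /cyc_quot_pi_eq0[t ht]].
  apply/cyc_quot_pi_eq0; exists t; apply: (bij_inj psi_bij).
  rewrite -[LHS](@hsubmxK _ 1 1 s) -[RHS](@hsubmxK _ 1 1 s) hv rsub_w.
  apply: (congr1 (fun z : 'cV_1 => row_mx z 0)); apply/rowP => j; rewrite ord1 !mxE.
  have -> : @lshift 1 s 0 = 0 :> 'I_s.+1 by apply: ord_inj.
  by rewrite ht raddfMz psi_w -[in RHS]scaler_int mxE delta_mxMn00 mulrzl.
have [t <-] := quotg_pi_surj y; have [psi' psiK psi'K] := psi_bij.
exists (pi (psi' (row_mx t%:M v))); rewrite fpi /= /h psi'K row_mxKr.
congr (_, quotg_pi _ _); have -> : 0 = @lshift 1 s 0 :> 'I_s.+1 by apply: ord_inj.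
by rewrite (@row_mxEl _ 1 1 s) mxE.
Qed.

Lemma zrank_cyc_quot : (0 < d)%N -> zrank (cyc_quot w) = s.
Proof.
move=> d0; have [f fbij] := cyc_quot_iso.
have pB : {morph (fun x => (f x).1) : x y / x - y} by move=> x y; rewrite raddfB.
apply: (zrank_torsion_kernel (p := additive_of pB) d0) => [y|x /= fx].
  by case: fbij => f' _ f'K; exists (f' (y, 0)); rewrite /= f'K.
apply: (bij_inj fbij); rewrite raddfMn raddf0 [f x]surjective_pairing fx.
have [t <-] := quotg_pi_surj (f x).2.
rewrite [LHS]surjective_pairing !raddfMn /= mul0rn -raddfMn; congr (_, _).
by apply/cyc_quot_pi_eq0; exists t; rewrite -mulrzl -mulr_natr mulrC natz intz mulrC.
Qed.

(** The coordinates modulo [d] vanish on [w], so they give a surjection from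
    [G / Zw] to [(Z/d)^(s+1)] which bounds the ideal from above; the case
    [d = 1] is apart because ['Z_1] is not the zero ring.  In the presentation
    with the single relation [w], the entry [d] of [psi w] is a minor of size
    [(s + 1) - s = 1]. *)
Lemma fitt_cyc_quot : (0 < d)%N -> fitt (cyc_quot w) s = ideal_gen [set d%:Z].
Proof.
move=> d0; apply/seteqP; split=> x.
  move=> xf; apply/ideal_gen_int; have [d1|] := ltnP 1 d; last first.
    by case: (d) d0 => [|[|]] // _ _; rewrite dvd1z.
  apply: intr_Zp_eq0 => //.
  have hB : {morph (fun x => map_mx (intr : int -> 'Z_d) (psi x)) : x y / x - y}.
    by move=> y z; rewrite !raddfB.
  have hw : additive_of hB w = 0.
    apply/rowP => j; rewrite !mxE psi_w mulmxnE rmorphMn /=.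
    by rewrite -mulr_natr pchar_Zp ?mulr0.
  have [p pP] := cyc_quot_lift hw.
  apply: (fitt_vanish (p := p)) xf => // j.
  have [psi' psiK psi'K] := psi_bij.
  by exists (pi (psi' (delta_mx 0 j))); rewrite pP /= psi'K map_delta_mx.
have [psi' psiK psi'K] := psi_bij.
pose u i := psi' (delta_mx 0 i).
have psi_u c : psi (zcomb u c) = c by exact: zcomb_coordinates.
move=> xd; exists 1%N, s.+1, (pi \o u), (psi w); split; last first.
  rewrite subSnn; move: x xd; apply: ideal_gen_sub; first exact: ideal_gen_is_ideal.
  move=> _ ->; apply: sub_ideal_gen; exists (fun=> 0), (fun=> 0).
  split; try by move=> i j; rewrite !ord1.
  by rewrite det_mx11 mxE psi_w delta_mxMn00.
split=> [y|c].
  have [z <-] := quotg_pi_surj y; exists (psi z).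
  by rewrite -raddf_zcomb; congr (pi _); apply: (bij_inj psi_bij); rewrite psi_u.
rewrite -raddf_zcomb cyc_quot_pi_eq0; split=> [[t e]|[b cE]].
  by exists t%:M; rewrite -[c]psi_u e raddfMz mul_scalar_mx -scaler_int intz.
exists (b 0 0); apply: (bij_inj psi_bij).
by rewrite psi_u cE raddfMz [b in LHS]mx11_scalar mul_scalar_mx -scaler_int intz.
Qed.

(** For [d > 0] the two Fitting ideals differ: [d] lies in the one of [G / Zw],
    whereas the one of [G] is zero, by the surjection [psi] onto [Z^(s+1)]. *)
Lemma torsion_numberE : torsion_number w = d.
Proof.
rewrite /torsion_number; have [d0|d0] := posnP d.
  have w0 : w = 0 by apply: (bij_inj psi_bij); rewrite psi_w raddf0 d0.
  rewrite asboolT ?d0 //; apply: (fitt_iso (f := pi)).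
  apply: additive_bij; last exact: quotg_pi_surj.
  by move=> x /cyc_quot_pi_eq0[t ->]; rewrite w0 mul0rz.
rewrite zrank_cyc_quot // fitt_cyc_quot // asboolF.
  apply: xget_unique => // e de; apply/eqP; rewrite eqn_dvd.
  have gen (k : nat) : ideal_gen [set k%:Z] k%:Z by apply/ideal_gen_int; apply: dvdzz.
  move: (gen e) (gen d); rewrite -de {2}de.
  by move=> /ideal_gen_int ? /ideal_gen_int ?; apply/andP.
move=> Gd; have : fitt G s d by rewrite Gd; apply/ideal_gen_int; apply: dvdzz.
have psi_surj j : exists y, psi y = delta_mx 0 j.
  by have [psi' _ psi'K] := psi_bij; exists (psi' (delta_mx 0 j)).
move=> /(fitt_vanish psi_surj (ltnSn s)); rewrite intz => /eqP.
by case: (d) d0.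
Qed.

Lemma part_of_basisE : part_of_basis w <-> d = 1%N.
Proof.
have [psi' psiK psi'K] := psi_bij.
split=> [[n [v [[fv gv] [i vi]]]]|d1].
  (* The element with coordinates [(1, 0, ..., 0)] satisfies [d x = w = v_i];
     compare the i-th coordinates with respect to the basis [v]. *)
  have [c cE] := gv (psi' (delta_mx 0 0)).
  have : delta_mx 0 i - d%:Z *: c = 0.
    apply: fv; rewrite zcombB zcombMz zcomb_delta vi -cE; apply/eqP; rewrite subr_eq0.
    by apply/eqP/(bij_inj psi_bij); rewrite raddfMz psi'K psi_w pmulrn.
  move=> /rowP/(_ i); rewrite !mxE !eqxx => /eqP; rewrite subr_eq0 => /eqP e.
  apply/eqP; rewrite -[_ == _](dvdz1 d); apply/dvdzP; exists (c 0 i).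
  by rewrite mulrC -e.
exists s.+1, (fun i => psi' (delta_mx 0 i)); split; last first.
  by exists 0; apply: (bij_inj psi_bij); rewrite psi'K psi_w d1.
split=> [c c0|x]; first by rewrite -[c](zcomb_coordinates _ psi'K) c0 raddf0.
by exists (psi x); apply: (bij_inj psi_bij); rewrite (zcomb_coordinates _ psi'K).
Qed.

End AdaptedCyclicQuotient.

(** * The class of the canonical module *)

Unset Implicit Arguments.
Set Strict Implicit.
Set Printing Implicit Defensive.

Theorem lemma1p2 (R : idomainType) (S : setting R)
    (icR : integrally_closed R) (cmR : cohen_macaulay R)
    (omega : lmodType R) (omegaP : canonical_module S omega)
    (W : Div (setting_noetherian S) icR) (WP : module_iso_ideal omega (div_set W))
    (r : nat) (r_ge1 : (1 <= r)%N)
    (phi : {additive Cl (setting_noetherian S) icR -> 'rV[int]_r})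
    (phi_bij : bijective phi)
    (a : 'I_r -> int) (aP : forall i, phi (Cl_class W) 0 i = a i) :
  [/\ torsion_number (Cl_class W) = \big[gcdn/0%N]_(i < r) `|a i|%N,
      zmod_isomorphic (reduced_Cl W)
        ('rV[int]_(r - 1) * cyc_quot (torsion_number (Cl_class W))%:Z)%type
    & part_of_basis (Cl_class W) <-> torsion_number (Cl_class W) = 1%N].
Proof.
case: r r_ge1 phi phi_bij a aP => // s _ phi phi_bij a aP.
have [psi psi_bij psi_w] := adapted_coordinates (Cl_class W) phi_bij.
have -> := torsion_numberE psi_bij psi_w.
split; last exact: part_of_basisE psi_bij psi_w.
  by apply: eq_bigr => i _; rewrite aP.
by rewrite subSS subn0; exact: cyc_quot_iso psi_bij psi_w.
Qed.
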